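(* Let $(\mathfrak{M},w)$ and $(\mathfrak{N},v)$ be pointed models over a signature $\Delta$. Then $(\mathfrak{M},w)$ and $(\mathfrak{N},v)$ are $\omega$-bisimilar if and only if $(\mathfrak{M},w)\approx_\omega(\mathfrak{N},v)$.
   Context: Hybrid-dynamic propositional logic (HDPL). A signature is $\Delta=((F,P),\mathtt{Prop})$ with $F$ nominals, $P$ binary relation symbols, $\mathtt{Prop}$ propositional symbols; $\Delta[x]$ adds a fresh nominal (variable) $x$. A $\Delta$-model $\mathfrak{M}$: a nonempty set $|\mathfrak{M}|$ of states, states $k^{\mathfrak{M}}$ ($k\in F$), relations $\lambda^{\mathfrak{M}}$ ($\lambda\in P$), and $M(w)\subseteq\mathtt{Prop}$ for each state $w$; $\mathfrak{M}[x\leftarrow w]$ is the $\Delta[x]$-expansion interpreting $x$ as $w$. Actions: $\mathfrak{a}::=\lambda\mid\mathfrak{a}\cup\mathfrak{a}\mid\mathfrak{a};\mathfrak{a}\mid\mathfrak{a}^*$, interpreted as union, composition, reflexive-transitive closure; $\mathfrak{a}^{\mathfrak{M}}(w)=\{w'\mid(w,w')\in\mathfrak{a}^{\mathfrak{M}}\}$. $\mathcal{L}$ is a fixed fragment of HDPL obtained by discarding some action constructors and/or some of the sentence constructors $\Diamond$ (possibility), $@$ (retrieve), $\downarrow$ (store), $\exists$ (existential quantifier over states); $\mathcal{O}\subseteq\{\Diamond,@,\downarrow,\exists\}$ is the set of retained constructors and $\mathcal{A}(\Delta)$ the set of $\mathcal{L}$-actions. Basic sentences: $F\cup\mathtt{Prop}$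 (a nominal $k$ holds at $w$ iff $w=k^{\mathfrak{M}}$, $p$ holds iff $p\in M(w)$). Countable EF game: played on the complete gameboard tree of height $\omega$, an infinite tree of signature-labelled nodes in which every node labelled $\Delta'$ has exactly one outgoing edge for each of: $1$ (to a node labelled $\Delta'$); $\downarrow$ (to $\Delta'[x]$, $x$ fresh) if $\downarrow\in\mathcal{O}$; $\exists$ (to $\Delta'[x]$) if $\exists\in\mathcal{O}$; $@_k$ for every nominal $k$ of $\Delta'$ (to $\Delta'$) if $@\in\mathcal{O}$; $\langle\mathfrak{a}\rangle$ for every $\mathfrak{a}\in\mathcal{A}(\Delta')$ (to $\Delta'$) if $\Diamond\in\mathcal{O}$. A position is a node with two pointed models over its signature, starting with $(\mathfrak{M},w),(\mathfrak{N},v)$ at the root. Eloise loses at a position if the two pointed models disagree on some basic sentence (game property). Otherwise Abelard picks an edge and one of the pointed models, say $(\mathfrak{M},w)$ (symmetric otherwise): $\langle\mathfrak{a}\rangle$: Abelard picks $w_1\in\mathfrak{a}^{\mathfrak{M}}(w)$, Eloise must pick $v_1\in\mathfrak{a}^{\mathfrak{N}}(v)$, new pair $(\mathfrak{M},w_1),(\mathfrak{N},v_1)$; $@_k$: $(\mathfrak{M},k^{\mathfrak{M}}),(\mathfrak{N},k^{\mathfrak{N}})$; $\downarrow$: $(\mathfrak{M}[x\leftarrow w],w),(\mathfrak{N}[x\leftarrow v],v)$; $\exists$: Abelard picks $w_1\in|\mathfrak{M}|$, Eloise $v_1\in|\mathfrak{N}|$, new pair $(\mathfrak{M}[x\leftarrow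 w_1],w),(\mathfrak{N}[x\leftarrow v_1],v)$; $1$: unchanged. $(\mathfrak{M},w)\approx_\omega(\mathfrak{N},v)$ means Eloise has a strategy keeping the game property at every position forever. $\omega$-bisimulation: a relation $B_\ell\subseteq(|\mathfrak{M}|^\ell\times|\mathfrak{M}|)\times(|\mathfrak{N}|^\ell\times|\mathfrak{N}|)$ is an $\ell$-bisimulation if for all $(\overline{w},w)\mathrel{B_\ell}(\overline{v},v)$: (prop) $p\in M(w)$ iff $p\in N(v)$; (nom) $w=k^{\mathfrak{M}}$ iff $v=k^{\mathfrak{N}}$; (wvar) $\overline{w}(j)=w$ iff $\overline{v}(j)=v$ ($1\le j\le\ell$); (forth) if $\Diamond\in\mathcal{O}$, for all $\mathfrak{a}\in\mathcal{A}(\Delta)$, $w'\in\mathfrak{a}^{\mathfrak{M}}(w)$ there is $v'\in\mathfrak{a}^{\mathfrak{N}}(v)$ with $(\overline{w},w')\mathrel{B_\ell}(\overline{v},v')$; (back) symmetric; (atv) if $@\in\mathcal{O}$, $(\overline{w},\overline{w}(j))\mathrel{B_\ell}(\overline{v},\overline{v}(j))$; (atn) if $@\in\mathcal{O}$, $(\overline{w},k^{\mathfrak{M}})\mathrel{B_\ell}(\overline{v},k^{\mathfrak{N}})$ for all $k\in F$. An $\omega$-bisimulation is a family $(B_\ell)_{\ell\in\omega}$ of $\ell$-bisimulations such that whenever $(\overline{w},w)\mathrel{B_\ell}(\overline{v},v)$: (st) if $\downarrow\in\mathcal{O}$, $(\overline{w}\,w,w)\mathrel{B_{\ell+1}}(\overline{v}\,v,v)$;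 (ex) if $\exists\in\mathcal{O}$, for all $w'\in|\mathfrak{M}|$ some $v'\in|\mathfrak{N}|$ has $(\overline{w}\,w',w)\mathrel{B_{\ell+1}}(\overline{v}\,v',v)$, and vice versa. $(\mathfrak{M},w)$, $(\mathfrak{N},v)$ are $\omega$-bisimilar if some $\omega$-bisimulation has $w\mathrel{B_0}v$. *)

(* Defs.v *)
From mathcomp Require Import all_boot.
From Stdlib Require Import Relation_Operators.

Set Implicit Arguments.
Unset Strict Implicit.
Unset Printing Implicit Defensive.

Record signature := Signature {
  nominal : Type;
  relsym : Type;
  propsym : Type }.

(* Delta[x]: the fresh nominal x is [None]. Relation symbols, hence actions,
   are unaffected. *)
Definition sig_ext (Delta : signature) : signature :=
  Signature (option (nominal Delta)) (relsym Delta) (propsym Delta).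

Record model (Delta : signature) := Model {
  state :> Type;
  state_nonempty : inhabited state;
  nom_of : nominal Delta -> state;
  rel_of : relsym Delta -> state -> state -> Prop;
  prop_of : state -> propsym Delta -> Prop }.

(* M[x <- w] *)
Definition expand (Delta : signature) (M : model Delta) (w : M) :
    model (sig_ext Delta) :=
  @Model (sig_ext Delta) M (state_nonempty M)
    (fun k => if k is Some k' then nom_of M k' else w)
    (@rel_of Delta M) (@prop_of Delta M).

Record pmodel (Delta : signature) := PModel {
  pm_model :> model Delta;
  point : pm_model }.
Arguments PModel {Delta} pm_model point.

Inductive action (P : Type) : Type :=
| Act of P
| ActUnion of action P & action P
| ActComp of action P & action P
| ActStar of action P.

Fixpoint act_of (Delta : signature) (M : model Delta)
    (a : action (relsym Delta)) : M -> M -> Prop :=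
  match a with
  | Act l => rel_of (m := M) l
  | ActUnion a1 a2 => fun w w' => act_of a1 w w' \/ act_of a2 w w'
  | ActComp a1 a2 => fun w w' => exists2 u : M, act_of a1 w u & act_of a2 u w'
  | ActStar a1 => clos_refl_trans M (act_of a1)
  end.

Inductive action_constructor := CUnion | CComp | CStar.

Inductive sentence_constructor := CPossibility | CRetrieve | CStore | CExists.

(* The retained constructors; atomic actions are always available. *)
Record fragment := Fragment {
  act_retained : pred action_constructor;
  sen_retained : pred sentence_constructor }.

(* Membership in A(Delta). *)
Fixpoint frag_action (L : fragment) (P : Type) (a : action P) : bool :=
  match a with
  | Act _ => true
  | ActUnion a1 a2 =>
      [&& act_retained L CUnion, frag_action L a1 & frag_action L a2]
  | ActComp a1 a2 =>
      [&& act_retained L CComp, frag_action L a1 & frag_action L a2]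
  | ActStar a1 => act_retained L CStar && frag_action L a1
  end.

Inductive basic (Delta : signature) : Type :=
| BNom of nominal Delta
| BProp of propsym Delta.

Definition sat_basic (Delta : signature) (A : pmodel Delta)
    (phi : basic Delta) : Prop :=
  match phi with
  | BNom k => point A = nom_of A k
  | BProp p => prop_of (point A) p
  end.

(* The edges leaving a node labelled Delta. The side conditions are boolean,
   hence proof-irrelevant, so there is exactly one edge of each kind. *)
Inductive edge (L : fragment) (Delta : signature) : Type :=
| EOne
| EStore of sen_retained L CStore
| EExists of sen_retained L CExists
| EAt (k : nominal Delta) of sen_retained L CRetrieve
| EPoss (a : action (relsym Delta)) of
    sen_retained L CPossibility & frag_action L a.

Definition target (L : fragment) (Delta : signature) (e : edge L Delta) :
    signature :=
  match e with
  | EStore _ | EExists _ => sig_ext Delta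
  | _ => Delta
  end.

(* A node of the complete gameboard tree of height omega rooted at Delta0,
   represented by the path of edges leading to it and indexed by its label. *)
Inductive node (L : fragment) (Delta0 : signature) : signature -> Type :=
| Root : node L Delta0 Delta0
| Child (Delta : signature) (n : node L Delta0 Delta) (e : edge L Delta) :
    node L Delta0 (target e).

(* What a player has to pick in the pointed model A once the edge e is fixed:
   a state for <a> and for the quantifier, nothing otherwise. *)
Definition choice_of (L : fragment) (Delta : signature) (e : edge L Delta)
    (A : pmodel Delta) : Type :=
  match e with
  | EExists _ | EPoss _ _ _ => A
  | _ => unit
  end.

Definition admissible (L : fragment) (Delta : signature) (e : edge L Delta)
    (A : pmodel Delta) : choice_of e A -> Prop :=
  match e return choice_of e A -> Prop with
  | EPoss a _ _ => fun w1 => act_of a (point A) w1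
  | _ => fun _ => True
  end.

(* The pointed model replacing A after the choice. *)
Definition outcome (L : fragment) (Delta : signature) (e : edge L Delta)
    (A : pmodel Delta) : choice_of e A -> pmodel (target e) :=
  match e return choice_of e A -> pmodel (target e) with
  | EOne => fun _ => A
  | EStore _ => fun _ => PModel (expand (point A)) (point A)
  | EExists _ => fun w1 => PModel (expand w1) (point A)
  | EAt k _ => fun _ => PModel A (nom_of A k)
  | EPoss _ _ _ => fun w1 => PModel A w1
  end.

Record position (L : fragment) (Delta0 : signature) := Position {
  label : signature;
  pos_node : node L Delta0 label;
  pos_left : pmodel label;
  pos_right : pmodel label }.

Definition game_property (L : fragment) (Delta0 : signature)
    (p : position L Delta0) : Prop :=
  forall phi : basic (label p),
    sat_basic (pos_left p) phi <-> sat_basic (pos_right p) phi.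

Inductive side := SLeft | SRight.

Definition other (s : side) : side := if s is SLeft then SRight else SLeft.

Definition pos_at (L : fragment) (Delta0 : signature) (p : position L Delta0)
    (s : side) : pmodel (label p) :=
  if s is SLeft then pos_left p else pos_right p.

(* Abelard picks an edge, one of the two pointed models and, where applicable,
   a state in it. *)
Record amove (L : fragment) (Delta0 : signature) (p : position L Delta0) :=
  AMove {
    am_edge : edge L (label p);
    am_side : side;
    am_choice : choice_of am_edge (pos_at p am_side) }.

Definition reply (L : fragment) (Delta0 : signature) (p : position L Delta0)
    (m : amove p) : Type :=
  choice_of (am_edge m) (pos_at p (other (am_side m))).

Definition next (L : fragment) (Delta0 : signature) (p : position L Delta0)
    (m : amove p) : reply m -> position L Delta0 :=
  match m return reply m -> position L Delta0 with
  | AMove e SLeft c => fun d =>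
      Position (Child (pos_node p) e)
        (@outcome _ _ e (pos_left p) c) (@outcome _ _ e (pos_right p) d)
  | AMove e SRight c => fun d =>
      Position (Child (pos_node p) e)
        (@outcome _ _ e (pos_left p) d) (@outcome _ _ e (pos_right p) c)
  end.

Record round (L : fragment) (Delta0 : signature) := Round {
  rd_pos : position L Delta0;
  rd_move : amove rd_pos;
  rd_reply : reply rd_move }.

(* Eloise's strategies may depend on the whole history. They are total
   functions; that the replies are admissible is required in [winning]. *)
Definition strategy (L : fragment) (Delta0 : signature) : Type :=
  seq (round L Delta0) -> forall (p : position L Delta0) (m : amove p), reply m.

(* [reachable sigma p0 h p]: a play from p0 in which Eloise follows sigma can
   have history h and current position p. *)
Inductive reachable (L : fragment) (Delta0 : signature)
    (sigma : strategy L Delta0) (p0 : position L Delta0) :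
    seq (round L Delta0) -> position L Delta0 -> Prop :=
| ReachStart : reachable sigma p0 [::] p0
| ReachStep h p (m : amove p) :
    reachable sigma p0 h p -> admissible (am_choice m) ->
    reachable sigma p0 (rcons h (Round (sigma h p m))) (next (sigma h p m)).

Definition winning (L : fragment) (Delta0 : signature)
    (sigma : strategy L Delta0) (p0 : position L Delta0) : Prop :=
  forall h p, reachable sigma p0 h p ->
    game_property p /\
    forall m : amove p, admissible (am_choice m) -> admissible (sigma h p m).

(* (M, w) ~~_omega (N, v) *)
Definition ef_equiv (L : fragment) (Delta : signature) (A B : pmodel Delta) :
    Prop :=
  exists sigma : strategy L Delta,
    winning sigma (Position (Root L Delta) A B).

Definition tuple_rel (Delta : signature) (M N : model Delta) (l : nat) :=
  l.-tuple M * M -> l.-tuple N * N -> Prop.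

Record is_bisimulation (L : fragment) (Delta : signature) (M N : model Delta)
    (l : nat) (B : tuple_rel M N l) : Prop := IsBisimulation {
  bis_prop : forall ws w vs v, B (ws, w) (vs, v) ->
    forall p : propsym Delta, prop_of w p <-> prop_of v p;
  bis_nom : forall ws w vs v, B (ws, w) (vs, v) ->
    forall k : nominal Delta, w = nom_of M k <-> v = nom_of N k;
  bis_wvar : forall ws w vs v, B (ws, w) (vs, v) ->
    forall j : 'I_l, tnth ws j = w <-> tnth vs j = v;
  bis_forth : sen_retained L CPossibility ->
    forall ws w vs v, B (ws, w) (vs, v) ->
    forall a : action (relsym Delta), frag_action L a ->
    forall w' : M, act_of a w w' ->
    exists2 v' : N, act_of a v v' & B (ws, w') (vs, v');
  bis_back : sen_retained L CPossibility ->
    forall ws w vs v, B (ws, w) (vs, v) ->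
    forall a : action (relsym Delta), frag_action L a ->
    forall v' : N, act_of a v v' ->
    exists2 w' : M, act_of a w w' & B (ws, w') (vs, v');
  bis_atv : sen_retained L CRetrieve ->
    forall ws w vs v, B (ws, w) (vs, v) ->
    forall j : 'I_l, B (ws, tnth ws j) (vs, tnth vs j);
  bis_atn : sen_retained L CRetrieve ->
    forall ws w vs v, B (ws, w) (vs, v) ->
    forall k : nominal Delta, B (ws, nom_of M k) (vs, nom_of N k) }.

Record is_omega_bisimulation (L : fragment) (Delta : signature)
    (M N : model Delta) (B : forall l, tuple_rel M N l) : Prop :=
  IsOmegaBisimulation {
  obis_level : forall l, is_bisimulation L (B l);
  obis_st : sen_retained L CStore ->
    forall l ws w vs v, B l (ws, w) (vs, v) ->
    B l.+1 ([tuple of rcons ws w], w) ([tuple of rcons vs v], v);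
  obis_ex_forth : sen_retained L CExists ->
    forall l ws w vs v, B l (ws, w) (vs, v) ->
    forall w' : M, exists v' : N,
      B l.+1 ([tuple of rcons ws w'], w) ([tuple of rcons vs v'], v);
  obis_ex_back : sen_retained L CExists ->
    forall l ws w vs v, B l (ws, w) (vs, v) ->
    forall v' : N, exists w' : M,
      B l.+1 ([tuple of rcons ws w'], w) ([tuple of rcons vs v'], v) }.

Definition omega_bisimilar (L : fragment) (Delta : signature)
    (A B : pmodel Delta) : Prop :=
  exists2 R : forall l, tuple_rel A B l,
    is_omega_bisimulation L R
    & R 0 ([tuple], point A) ([tuple], point B).

(* Main.v *)
From mathcomp Require Import all_boot.
From Stdlib Require Import Relation_Operators ClassicalEpsilon.
Require Import Defs.

Set Implicit Arguments.
Unset Strict Implicit.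
Unset Printing Implicit Defensive.

(** Both sides are equivalent to the existence of a back-and-forth system: a
    relation between pointed models over arbitrary signatures that preserves
    basic sentences and is closed under the moves of the game. The positions
    reachable against a winning strategy form such a system, and conversely
    Eloise wins by choosing replies that stay inside the system. An
    omega-bisimulation and a back-and-forth system then differ only in whether
    the states stored so far are recorded as tuples or as fresh nominals. *)

Record back_and_forth (L : fragment)
    (E : forall D : signature, pmodel D -> pmodel D -> Prop) : Prop :=
  BackAndForth {
  baf_basic : forall D (A B : pmodel D), E D A B ->
    forall phi : basic D, sat_basic A phi <-> sat_basic B phi;
  baf_forth : forall D (A B : pmodel D), E D A B ->
    forall (e : edge L D) (c : choice_of e A), admissible c ->
    exists2 d : choice_of e B, admissible d & E _ (outcome c) (outcome d);
  baf_back : forall D (A B : pmodel D), E D A B ->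
    forall (e : edge L D) (d : choice_of e B), admissible d ->
    exists2 c : choice_of e A, admissible c & E _ (outcome c) (outcome d) }.

(** The point of a pointed model serves as a default reply, so that [epsilon] can define a total
    strategy. *)
Lemma choice_inhabited (L : fragment) (D : signature) (e : edge L D)
  (A : pmodel D) : inhabited (choice_of e A).
Proof. by case: e => *; constructor; first [exact: tt | exact: point]. Qed.

Lemma ef_equiv_back_and_forth (L : fragment) (D : signature)
    (A B : pmodel D) :
  ef_equiv L A B <-> exists2 E, back_and_forth L E & E D A B.
Proof.
split=> [[sigma win]|[E bafE EAB]].
  (* [E] forgets the history and the node of a reachable position and keeps only its two pointed
     models. *)
  pose E D' (A' B' : pmodel D') := exists h (n : node L D D'),
    reachable sigma (Position (Root L D) A B) h (Position n A' B').
  exists E; last by exists [::], (Root L D); constructor.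
  split=> D' A' B' [h [n reach]]; have [gp adm] := win _ _ reach.
  - exact: gp.
  - move=> e c adm_c; pose m := @AMove L D (Position n A' B') e SLeft c.
    exists (sigma h _ m); first exact: adm m adm_c.
    by do 2 eexists; apply: (@ReachStep _ _ _ _ _ _ m reach adm_c).
  - move=> e d adm_d; pose m := @AMove L D (Position n A' B') e SRight d.
    exists (sigma h _ m); first exact: adm m adm_d.
    by do 2 eexists; apply: (@ReachStep _ _ _ _ _ _ m reach adm_d).
pose good (p : position L D) (m : amove p) (d : reply m) :=
  admissible d /\ E _ (pos_left (next d)) (pos_right (next d)).
(* This strategy ignores the history. [epsilon] returns a good reply whenever there is one, and an
   arbitrary reply otherwise. *)
pose sigma : strategy L D := fun _ p m =>
  epsilon (choice_inhabited (am_edge m) (pos_at p (other (am_side m))))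
          (@good p m).
have sigmaP h p (m : amove p) : E _ (pos_left p) (pos_right p) ->
    admissible (am_choice m) -> good p m (sigma h p m).
  move=> Ep adm_m; apply: epsilon_spec; move: adm_m.
  case: m => e [] c adm_c.
    by have [d] := baf_forth bafE Ep adm_c; exists d.
  by have [d] := baf_back bafE Ep adm_c; exists d.
exists sigma => h p reach.
(* Membership in [E] is an invariant of the plays following [sigma]. *)
have Ep : E _ (pos_left p) (pos_right p).
  by elim: reach => // h' p' m _ Ep' adm_m; have [] := sigmaP h' p' m Ep' adm_m.
split; first exact: (baf_basic bafE Ep).
by move=> m adm_m; have [] := sigmaP h p m Ep adm_m.
Qed.

(** Letting [K] be an arbitrary type gives all iterated expansions of [M] the same form. *)
Definition rename (D : signature) (M : model D) (K : Type) (f : K -> M) :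
    model (Signature K (relsym D) (propsym D)) :=
  @Model (Signature K (relsym D) (propsym D)) M (state_nonempty M) f
    (@rel_of D M) (@prop_of D M).

Lemma act_of_rename (D : signature) (M : model D) (K : Type) (f : K -> M)
    (a : action (relsym D)) :
  act_of (M := rename f) a = act_of (M := M) a.
Proof. by elim: a => //= [a -> b ->|a -> b ->|a ->]. Qed.

(* [expand (rename f) x] is convertible to [rename (extend f x)]. *)
Definition extend (K S : Type) (f : K -> S) (x : S) (k : option K) : S :=
  if k is Some k' then f k' else x.

Section NamedPairs.
Variables (D : signature) (M N : model D).

Local Notation sig K := (Signature K (relsym D) (propsym D)).

(** The pairs of states with a common name, whether a nominal of [D] or a tuple coordinate. The
    names in [K] are compared with these through the pairs they denote, with no bijection of
    names. *)
Definition named (l : nat) (ws : l.-tuple M) (vs : l.-tuple N)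
    (x : M) (y : N) : Prop :=
  (exists k, x = nom_of M k /\ y = nom_of N k) \/
  (exists j, x = tnth ws j /\ y = tnth vs j).

Lemma named_rcons l (ws : l.-tuple M) (vs : l.-tuple N) x' y' x y :
  named [tuple of rcons ws x'] [tuple of rcons vs y'] x y <->
  named ws vs x y \/ x = x' /\ y = y'.
Proof.
have widen T (t : l.-tuple T) z (j : 'I_l) :
    tnth [tuple of rcons t z] (widen_ord (leqnSn l) j) = tnth t j.
  by rewrite !(tnth_nth z) /= nth_rcons size_tuple ltn_ord.
have last T (t : l.-tuple T) z : tnth [tuple of rcons t z] ord_max = z.
  by rewrite (tnth_nth z) /= nth_rcons size_tuple ltnn eqxx.
split=> [[nm|[j [-> ->]]]|[[nm|[j [-> ->]]]|[-> ->]]].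
- by left; left.
- case: (unliftP ord_max j) => [i ->|->]; last by right; rewrite !last.
  (* Lifting past the largest index shifts nothing. *)
  have -> : lift ord_max i = widen_ord (leqnSn l) i.
    by apply: val_inj; rewrite /= /bump leqNgt ltn_ord.
  by left; right; exists i; rewrite !widen.
- by left.
- by right; exists (widen_ord (leqnSn l) j); rewrite !widen.
- by right; exists ord_max; rewrite !last.
Qed.

(** Every name in [K] denotes a named pair, so a test or retrieve at a name in the game becomes a
    clause of the bisimulation about a nominal or a coordinate. *)
Inductive system_of_bisim (R : forall l, tuple_rel M N l) :
    forall D' : signature, pmodel D' -> pmodel D' -> Prop :=
| SystemOfBisim l (ws : l.-tuple M) w (vs : l.-tuple N) v
    (K : Type) (f : K -> M) (g : K -> N) :
    R l (ws, w) (vs, v) -> (forall k, named ws vs (f k) (g k)) ->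
    @system_of_bisim R (sig K)
      (PModel (rename f) w) (PModel (rename g) v).

Lemma named_extend l (ws : l.-tuple M) (vs : l.-tuple N) (K : Type)
    (f : K -> M) (g : K -> N) x y :
  (forall k, named ws vs (f k) (g k)) ->
  forall k, named [tuple of rcons ws x] [tuple of rcons vs y]
                  (extend f x k) (extend g y k).
Proof.
by move=> nm [k|]; apply/named_rcons; [left; apply: nm | right].
Qed.

Lemma system_of_bisimP (L : fragment) (R : forall l, tuple_rel M N l) :
  is_omega_bisimulation L R -> back_and_forth L (system_of_bisim R).
Proof.
move=> bisR; have lev := obis_level bisR.
have at_named l (ws : l.-tuple M) w (vs : l.-tuple N) v x y :
    sen_retained L CRetrieve -> R l (ws, w) (vs, v) -> named ws vs x y ->
    R l (ws, x) (vs, y).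
  move=> ret Rwv [[k [-> ->]]|[j [-> ->]]].
    exact: (bis_atn (lev l) ret Rwv).
  exact: (bis_atv (lev l) ret Rwv).
split=> _ _ _ [l ws w vs v K f g Rwv nm].
- case=> [k|p] /=; last exact: (bis_prop (lev l) Rwv).
  case: (nm k) => [[k0 [-> ->]]|[j [-> ->]]].
    exact: (bis_nom (lev l) Rwv).
  by have [h1 h2] := bis_wvar (lev l) Rwv j; split=> /esym; [move/h1 | move/h2] => /esym.
- case=> [|st|ex|k ret|a poss fa] /= c adm_c.
  + by exists tt => //; apply: SystemOfBisim Rwv nm.
  + exists tt => //.
    (* The stored states become the last coordinates of the tuples, and the fresh nominal is
       interpreted by [extend]. *)
    exact: (@SystemOfBisim R l.+1 _ _ _ _ _ (extend f w) (extend g v)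
      (obis_st bisR st Rwv) (named_extend _ _ nm)).
  + have [d Rd] := obis_ex_forth bisR ex Rwv c.
    exists d => //.
    exact: (@SystemOfBisim R l.+1 _ _ _ _ _ (extend f c) (extend g d)
      Rd (named_extend _ _ nm)).
  + exists tt => //.
    exact: SystemOfBisim (at_named _ _ _ _ _ _ _ ret Rwv (nm k)) nm.
  + rewrite act_of_rename in adm_c.
    have [d ad Rd] := bis_forth (lev l) poss Rwv fa adm_c.
    by exists d; [rewrite act_of_rename | apply: SystemOfBisim Rd nm].
- case=> [|st|ex|k ret|a poss fa] /= d adm_d.
  + by exists tt => //; apply: SystemOfBisim Rwv nm.
  + exists tt => //.
    exact: (@SystemOfBisim R l.+1 _ _ _ _ _ (extend f w) (extend g v)
      (obis_st bisR st Rwv) (named_extend _ _ nm)).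
  + have [c Rc] := obis_ex_back bisR ex Rwv d.
    exists c => //.
    exact: (@SystemOfBisim R l.+1 _ _ _ _ _ (extend f c) (extend g d)
      Rc (named_extend _ _ nm)).
  + exists tt => //.
    exact: SystemOfBisim (at_named _ _ _ _ _ _ _ ret Rwv (nm k)) nm.
  + rewrite act_of_rename in adm_d.
    have [c ac Rc] := bis_back (lev l) poss Rwv fa adm_d.
    by exists c; [rewrite act_of_rename | apply: SystemOfBisim Rc nm].
Qed.

(** Here the inclusion is reversed: every named pair has a name in [K], so each clause about a
    nominal or a coordinate becomes a basic sentence or an edge of the game over [K]. *)
Definition bisim_of_system
    (E : forall D' : signature, pmodel D' -> pmodel D' -> Prop) (l : nat) :
    tuple_rel M N l :=
  fun wsw vsv => exists (K : Type) (f : K -> M) (g : K -> N),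
    E (sig K)
      (PModel (rename f) wsw.2) (PModel (rename g) vsv.2) /\
    forall x y, named wsw.1 vsv.1 x y -> exists k, x = f k /\ y = g k.

Lemma extend_named l (ws : l.-tuple M) (vs : l.-tuple N) (K : Type)
    (f : K -> M) (g : K -> N) x' y' :
  (forall x y, named ws vs x y -> exists k, x = f k /\ y = g k) ->
  forall x y, named [tuple of rcons ws x'] [tuple of rcons vs y'] x y ->
  exists k, x = extend f x' k /\ y = extend g y' k.
Proof.
move=> nm x y /named_rcons[/nm[k [-> ->]]|[-> ->]].
  by exists (Some k).
by exists None.
Qed.

Lemma bisim_of_systemP (L : fragment)
    (E : forall D' : signature, pmodel D' -> pmodel D' -> Prop) :
  back_and_forth L E -> is_omega_bisimulation L (bisim_of_system E).
Proof.
move=> bafE.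
(* This yields both (nom) and (wvar): being equal to a named state is a basic sentence over [K]. *)
have eq_named l (ws : l.-tuple M) w (vs : l.-tuple N) v x y :
    bisim_of_system E (ws, w) (vs, v) -> named ws vs x y ->
    w = x <-> v = y.
  move=> [K [f [g [/= Ewv nm]]]] /nm[k [-> ->]].
  exact: (baf_basic bafE Ewv (@BNom (sig K) k)).
have at_named l (ws : l.-tuple M) w (vs : l.-tuple N) v x y :
    sen_retained L CRetrieve ->
    bisim_of_system E (ws, w) (vs, v) -> named ws vs x y ->
    bisim_of_system E (ws, x) (vs, y).
  move=> ret [K [f [g [/= Ewv nm]]]] /nm[k [-> ->]]; exists K, f, g; split=> //.
  (* The reply at a retrieve edge carries no state, so the resulting pair is the one denoted by
     [k]. *)
  by have [] := baf_forth bafE Ewv (e := @EAt L (sig K) k ret) (c := tt) I.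
split; first split.
- move=> ws w vs v [K [f [g [/= Ewv _]]]] p.
  exact: (baf_basic bafE Ewv (@BProp (sig K) p)).
- by move=> ws w vs v Rwv k; apply: eq_named Rwv _; left; exists k.
- move=> ws w vs v Rwv j.
  have [|h1 h2] := eq_named _ _ _ _ _ (tnth ws j) (tnth vs j) Rwv.
    by right; exists j.
  by split=> /esym; [move/h1 | move/h2] => /esym.
- move=> poss ws w vs v [K [f [g [/= Ewv nm]]]] a fa w' aw.
  have := baf_forth bafE Ewv (e := @EPoss L (sig K) a poss fa) (c := w').
  rewrite /= !act_of_rename => /(_ aw) [v' av' E'].
  by exists v' => //; exists K, f, g.
- move=> poss ws w vs v [K [f [g [/= Ewv nm]]]] a fa v' av.
  have := baf_back bafE Ewv (e := @EPoss L (sig K) a poss fa) (d := v').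
  rewrite /= !act_of_rename => /(_ av) [w' aw' E'].
  by exists w' => //; exists K, f, g.
- by move=> ret ws w vs v Rwv j; apply: at_named ret Rwv _; right; exists j.
- by move=> ret ws w vs v Rwv k; apply: at_named ret Rwv _; left; exists k.
- move=> st l ws w vs v [K [f [g [/= Ewv nm]]]].
  have [d _ E'] := baf_forth bafE Ewv (e := @EStore L (sig K) st) (c := tt) I.
  by exists (option K), (extend f w), (extend g v); split=> //; apply: extend_named.
- move=> ex l ws w vs v [K [f [g [/= Ewv nm]]]] w'.
  have [v' _ E'] := baf_forth bafE Ewv (e := @EExists L (sig K) ex) (c := w') I.
  exists v', (option K), (extend f w'), (extend g v').
  by split=> //; apply: extend_named.
- move=> ex l ws w vs v [K [f [g [/= Ewv nm]]]] v'.
  have [w' _ E'] := baf_back bafE Ewv (e := @EExists L (sig K) ex) (d := v') I.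
  exists w', (option K), (extend f w'), (extend g v').
  by split=> //; apply: extend_named.
Qed.

End NamedPairs.

Theorem mainTheorem4 (L : fragment) (Delta : signature)
  (M N : model Delta) (w : M) (v : N) :
  omega_bisimilar L (PModel M w) (PModel N v) <->
  ef_equiv L (PModel M w) (PModel N v).
Proof.
rewrite ef_equiv_back_and_forth.
(* Once the records are destructed, [M] is convertible to
   [rename (nom_of M)]. *)
case: Delta M N w v => K R P [M iM nM rM pM] [N iN nN rN pN] w v.
set A := Model _ _ _ _; set B := Model _ _ _ _.
split=> [[Rb bisR Rwv]|[E bafE Ewv]].
  exists (system_of_bisim Rb); first exact: system_of_bisimP.
  (* At level 0 the tuples are empty, and the names are exactly the original nominals. *)
  apply: (@SystemOfBisim _ A B Rb 0 _ _ _ _ K nM nN Rwv) => k.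
  by left; exists k.
exists (@bisim_of_system _ A B E); first exact: bisim_of_systemP.
(* A coordinate of an empty tuple would be an element of ['I_0], so only nominals name pairs. *)
exists K, nM, nN; split=> //= x y [[k [-> ->]]|[[]//]].
by exists k.
Qed.
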